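(* Let $G$ be a graph of order $n$, without isolated vertices. Then for every integer $k\ge 3$ we have $$\psi_k(G) \le n- \frac{2k-3}{k-1} \sum_{v\in V(G)}\frac{1}{1+d(v)}.$$
   Context: Graphs are finite, simple and undirected. The order of $G$ is $n=|V(G)|$, and $d(v)$ denotes the degree of the vertex $v$ in $G$. $P_k$ denotes the path with $k$ vertices. A $k$-path vertex cover of $G$ is a set $T\subseteq V(G)$ such that $G-T$ contains no (not necessarily induced) subgraph isomorphic to $P_k$. $\psi_k(G)$ is the minimum cardinality of a $k$-path vertex cover of $G$. *)

(* Defs.v *)
From mathcomp Require Import all_boot all_order all_algebra.

Set Implicit Arguments.
Unset Strict Implicit.
Unset Printing Implicit Defensive.

(* A finite simple undirected graph is a symmetric irreflexive
   relation [e] on a finType [V]. *)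
Section PathVertexCover.

Variables (V : finType) (e : rel V).

Definition degree (v : V) : nat := #|[set u | e v u]|.

Definition no_isolated_vertex : Prop := forall v : V, 0 < degree v.

(* A not necessarily induced copy of P_k (k vertices) in the subgraph induced
   by [A], given by its vertices listed in order. *)
Definition contains_path (k : nat) (A : {set V}) : bool :=
  [exists p : k.-tuple V, [&& uniq p, sorted e p & all (fun v => v \in A) p]].

Definition path_vertex_cover (k : nat) (T : {set V}) : bool :=
  ~~ contains_path k (~: T).

(* For k > 0 the default [setT] is itself a k-path vertex cover, so this is
   a genuine minimum. *)
Definition psi (k : nat) : nat :=
  #|[arg min_(T < [set: V] | path_vertex_cover k T) #|T|]|.

Lemma path_vertex_cover_setT (k : nat) :
  0 < k -> path_vertex_cover k [set: V].
Proof.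
case: k => // k _; apply/existsP => -[p /and3P[_ _ /allP pA]].
by have := pA _ (mem_tnth ord0 p); rewrite setCT inE.
Qed.

Lemma psiP (k : nat) : 0 < k ->
  (exists2 T : {set V}, path_vertex_cover k T & #|T| = psi k) /\
  (forall T : {set V}, path_vertex_cover k T -> psi k <= #|T|).
Proof.
move=> k0; rewrite /psi; case: arg_minnP; first exact: path_vertex_cover_setT.
by move=> T covT minT; split=> //; exists T.
Qed.

End PathVertexCover.

(* Main.v *)
Require Import Defs.
From mathcomp Require Import all_boot all_order all_algebra.
From mathcomp Require Import fingroup perm zify ring lra.

(** Put the vertices in a uniformly random order and keep the set [F] of those
vertices that have at most one earlier neighbour.  The rank of [v] among the
[1 + d(v)] vertices of its closed neighbourhood is uniformly distributed, so
[v] has no earlier neighbour with probability [1 / (1 + d(v))], and, because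
[d(v) > 0], exactly one with the same probability
([card_perm_leq_rank_eq]).

The graph induced by [F] is a forest in which the parent of a vertex is its
earlier neighbour, if that lies in [F].  Let [F1] be the set of vertices of [F]
with exactly one earlier neighbour.  The paths with [k] vertices in [F] can all
be destroyed by deleting at most [|F1| / (k - 1)] vertices
([forest_path_cover]).  Indeed, a path in a forest has a top vertex, and all
its other vertices have their parent on the path.  Choose a path whose top [v]
is as late as possible and delete [v].  Every surviving path is then disjoint
from the chosen one: climbing from a common vertex along both paths would lead
to [v], or to a top later than [v].  So the [k - 1] vertices of the chosen path
below [v], all in [F1], are used up by the deletion of [v] alone.

With [R] the set of vertices without earlier neighbour, the surviving set has at
least [|R| + |F1| - |F1| / (k - 1)] vertices.  Its expectation is at least
[(1 + 1 - 1 / (k - 1)) * \sum_v 1 / (1 + d(v))], and some order does at least as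
well as the average. *)

Set Implicit Arguments.
Unset Strict Implicit.
Unset Printing Implicit Defensive.

Import Order.TTheory GRing.Theory Num.Theory.

(** * Destroying the paths of a forest *)

Section Forest.

Variables (V : finType) (e : rel V) (f : V -> nat).
Hypotheses (e_sym : symmetric e) (e_irr : irreflexive e) (f_inj : injective f).

Definition earlier_nbr (x y : V) : bool := e x y && (f y < f x).

Definition unique_earlier_nbr (F : {set V}) : Prop :=
  forall x y z, x \in F -> earlier_nbr x y -> earlier_nbr x z -> y = z.

Definition is_top (p : seq V) (t : V) : bool :=
  (t \in p) &&
  all (fun x => (x == t) || has (fun y => earlier_nbr x y) p) p.

(** Each edge of a path points from its later to its earlier end, and no vertex
is the later end of two edges.  So a vertex added in front of a path is either
a child of the old first vertex, or the parent of it; in the latter case the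
old first vertex had no parent on the path, hence was the top. *)
Lemma path_has_top (F : {set V}) (p : seq V) :
  unique_earlier_nbr F -> 0 < size p -> uniq p -> sorted e p ->
  {subset p <= F} -> exists t, is_top p t.
Proof.
move=> uF; case: p => // x p _.
elim: p x => [|y p IH] x.
  by move=> _ _ _; exists x; rewrite /is_top mem_head /= eqxx.
rewrite cons_uniq => /andP[xNp uyp] /= /andP[exy pyp] sF.
have sF' : {subset y :: p <= F} by move=> z zp; apply: sF; rewrite inE zp orbT.
have [t /andP[tp /allP topt]] := IH y uyp pyp sF'.
have old z : z \in y :: p -> z != t ->
    exists2 u, u \in y :: p & earlier_nbr z u.
  by move=> zp /negPf zt; have := topt z zp; rewrite zt => /hasP.
have keep z : z \in y :: p -> z != t -> has (earlier_nbr z) [:: x, y & p].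
  move=> zp zt; have [u up zu] := old z zp zt.
  by apply/hasP; exists u; rewrite // inE up orbT.
have [fyx|fxy|fxy] := ltngtP (f y) (f x).
- exists t; rewrite /is_top inE tp orbT; apply/allP => z.
  rewrite inE => /predU1P[->|zp].
    by apply/orP; right; apply/hasP; exists y;
      rewrite ?inE ?eqxx ?orbT // /earlier_nbr exy.
  by case: eqVneq => //= zt; apply: keep.
- have yx : earlier_nbr y x by rewrite /earlier_nbr e_sym exy.
  have yt : y = t.
    apply/eqP/negPn/negP => yt; have [u up yu] := old y (mem_head _ _) yt.
    have ux : u = x by apply: (uF y) => //; apply: sF'; apply: mem_head.
    by rewrite -ux up in xNp.
  exists x; rewrite /is_top mem_head; apply/allP => z.
  rewrite inE => /predU1P[->|zp]; first by rewrite eqxx.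
  case: (eqVneq z t) => [->|zt]; last by rewrite keep ?orbT.
  by rewrite -yt; apply/orP; right; apply/hasP; exists x; rewrite ?mem_head.
- by move/f_inj: fxy => yx; rewrite yx e_irr in exy.
Qed.

Lemma top_min (p : seq V) (t x : V) :
  is_top p t -> x \in p -> x != t -> f t < f x.
Proof.
move=> /andP[_ /allP topt].
elim/ltn_ind: (f x) {-2}x (erefl (f x)) => m IH {}x fx xp xt.
have := topt x xp; rewrite (negPf xt) => /hasP[y yp /andP[_ fyx]].
rewrite fx in fyx.
case: (eqVneq y t) => [<-|yt]; first by rewrite fx.
by rewrite fx; apply: ltn_trans (IH (f y) fyx y _ _ _) fyx.
Qed.

Lemma top_earlier_nbr (p : seq V) (t x : V) :
  is_top p t -> x \in p -> x != t ->
  exists2 y, y \in p & earlier_nbr x y.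
Proof.
by move=> /andP[_ /allP topt] xp /negPf xt; have := topt x xp; rewrite xt => /hasP.
Qed.

(** Choosing the path with the latest top lets the deletion of that top be paid
for by the other [k - 1] vertices of the path, which no surviving path meets.
Paying only with vertices that have an earlier neighbour, never with the top, is
what yields the factor [2 - 1 / (k - 1)]; deleting one vertex out of [k] of the
forest would only give [2 * (1 - 1 / k)]. *)
Lemma forest_path_cover (k : nat) (F : {set V}) :
  0 < k -> unique_earlier_nbr F ->
  exists D : {set V}, [/\ D \subset F, ~~ contains_path e k (F :\: D) &
    k.-1 * #|D| <= #|[set x in F | [exists y, earlier_nbr x y]]|].
Proof.
move=> k0; have [n] := ubnP #|F|; elim: n F => // n IH F /ltnSE cF uF.
have [/existsP[p0 /and3P[up0 sp0 /allP p0F]]|noP] := boolP (contains_path e k F);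
  last first.
  by exists set0; rewrite sub0set setD0 cards0 muln0.
pose topOf (t : V) := [exists p : k.-tuple V,
  [&& uniq p, sorted e p, all (fun v => v \in F) p & is_top p t]].
have [t0 topt0] : exists t, is_top p0 t.
  by apply: (path_has_top uF) => //; rewrite size_tuple.
have topOf0 : topOf t0.
  by apply/existsP; exists p0; rewrite up0 sp0 topt0 andbT; apply/allP.
case: (arg_maxnP f topOf0) => v /existsP[p /and4P[up sp /allP pF topv]] vmax.
pose P := [set x in p].
have vP : v \in P by rewrite inE; case/andP: topv.
have PF : P \subset F by apply/subsetP => x; rewrite inE => /pF.
have cP : #|P| = k by rewrite cardsE (card_uniqP up) size_tuple.
have [||D [DF noPD cD]] := IH (F :\: P).
- apply: leq_trans cF; apply: proper_card; apply/properP; split.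
    exact: subsetDl.
  by exists v; [apply: (subsetP PF) | rewrite inE vP].
- by move=> x y z /setDP[xF _]; apply: uF.
exists (v |: D); split.
- rewrite subUset sub1set (subsetP PF) //=.
  exact: subset_trans DF (subsetDl _ _).
- apply: contra noPD => /existsP[q /and3P[uq sq /allP qF]].
  have qF' : {subset q <= F} by move=> x /qF /setDP[].
  have qv : v \notin q by apply/negP => /qF; rewrite !inE eqxx.
  apply/existsP; exists q; rewrite uq sq; apply/allP => x xq.
  have /setDP[xF] := qF x xq; rewrite !inE negb_or => /andP[xv xD].
  rewrite xD xF andbT /=.
  have [t topt] : exists t, is_top q t.
    by apply: (path_has_top uF) => //; rewrite size_tuple.
  have tv : f t <= f v.
    apply: vmax; apply/existsP; exists q; rewrite uq sq topt andbT /=.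
    exact/allP.
  apply/negP => xp.
  (* At the earliest common vertex [z], the parents of [z] on the two paths
     coincide and would be an earlier common vertex, unless [z] is a top. *)
  have xpq : (x \in p) && (x \in q) by rewrite xp.
  case: (@arg_minnP _ x (fun z => (z \in p) && (z \in q)) f xpq) => z.
  move=> /andP[zp zq] zmin.
  have zv : z != v by apply: contraNneq qv => <-.
  have [zt|zt] := eqVneq z t.
    by have := top_min topv zp zv; rewrite zt ltnNge tv.
  have [y yp zy] := top_earlier_nbr topv zp zv.
  have [y' yq zy'] := top_earlier_nbr topt zq zt.
  have yy' := uF z y y' (pF z zp) zy zy'.
  have := zmin y; rewrite yp yy' yq => /(_ isT).
  by case/andP: zy' => _; rewrite ltnNge => /negP.
- set A := [set x in F | _]; set B := [set x in F :\: P | _] in cD.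
  have dBP : [disjoint B & P :\ v].
    rewrite -setI_eq0; apply/eqP/setP => x; rewrite !inE.
    by case: (x \in p); rewrite ?andbF.
  have sBA : B :|: P :\ v \subset A.
    rewrite subUset; apply/andP; split; apply/subsetP => x.
      by rewrite !inE => /andP[/andP[_ ->] ->].
    move=> /setD1P[xv]; rewrite inE => xp; rewrite inE pF //=.
    have [y _ xy] := top_earlier_nbr topv xp xv.
    by apply/existsP; exists y.
  have := subset_leq_card sBA; rewrite cardsU (disjoint_setI0 dBP) cards0 subn0.
  have -> : #|P :\ v| = k.-1 by have := cardsD1 v P; rewrite vP cP => ->.
  have vD : v \notin D by apply: contraL vP => /(subsetP DF) /setDP[].
  move: cD; rewrite cardsU1 vD /= => cD; apply: leq_trans.
  by rewrite mulnDr muln1 addnC leq_add2r.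
Qed.

End Forest.

(** * The rank of a vertex in a random order *)

Section RandomRank.

Variable V : finType.
Implicit Types (s : {perm V}) (S : {set V}) (u v w : V).

Definition position s v : nat := enum_rank (s v).

Lemma position_inj s : injective (position s).
Proof. by move=> u v /val_inj /enum_rank_inj /perm_inj. Qed.

Definition rank_in s S v : nat := #|[set u in S | position s u < position s v]|.

Lemma rank_in_lt s S u v :
  u \in S -> position s u < position s v -> rank_in s S u < rank_in s S v.
Proof.
move=> uS suv; apply: proper_card; apply/properP; split.
  apply/subsetP => w; rewrite !inE => /andP[-> swu] /=.
  exact: ltn_trans swu suv.
by exists u; rewrite !inE uS ?suv // ltnn.
Qed.

Lemma rank_in_card s S v : v \in S -> rank_in s S v < #|S|.
Proof.
move=> vS; apply: proper_card; apply/properP; split.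
  by apply/subsetP => u; rewrite inE => /andP[].
by exists v; rewrite // inE ltnn andbF.
Qed.

Lemma rank_in_surj s S (j : nat) :
  j < #|S| -> exists2 u, u \in S & rank_in s S u = j.
Proof.
case cS: #|S| => [//|m] jm.
pose r u : 'I_m.+1 := inord (rank_in s S u).
have rE u : u \in S -> r u = rank_in s S u :> nat.
  by move=> uS; rewrite inordK // -cS rank_in_card.
have r_inj : {in S &, injective r}.
  move=> u v uS vS /(congr1 val) /=; rewrite !rE // => ruv.
  apply: (@position_inj s).
  case: (ltngtP (position s u) (position s v)) => // suv.
    by have := rank_in_lt uS suv; rewrite ruv ltnn.
  by have := rank_in_lt vS suv; rewrite ruv ltnn.
have rS : r @: S = [set: 'I_m.+1].
  by apply/eqP; rewrite eqEcard subsetT cardsT card_ord card_in_imset ?cS /=.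
have : Ordinal jm \in r @: S by rewrite rS inE.
by case/imsetP => u uS ju; exists u => //; rewrite -rE // -ju.
Qed.

(** The transposition permutes [S], so it carries the elements of [S] that
precede [u] in the new order onto those that precede [v] in the old one. *)
Lemma rank_in_tperm s S u v :
  u \in S -> v \in S -> rank_in (tperm u v * s)%g S u = rank_in s S v.
Proof.
move=> uS vS.
have tS w : (tperm u v w \in S) = (w \in S) by case: tpermP => [->|->|] //; rewrite uS vS.
rewrite /rank_in -(card_imset _ (@perm_inj _ (tperm u v))).
apply: eq_card => w; apply/imsetP/idP => [[x + ->]|].
  by rewrite !inE /position !permM tpermL tS.
rewrite inE => /andP[wS swv]; exists (tperm u v w); last by rewrite tpermK.
by rewrite inE tS wS /position !permM tpermK tpermL.
Qed.

(** Every order gives rank [j] to some element of [S], and by symmetry all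
elements of [S] have rank [j] in equally many orders. *)
Lemma card_perm_leq_rank_eq S v (j : nat) :
  v \in S -> j < #|S| ->
  #|{perm V}| <= #|S| * #|[set s | rank_in s S v == j]|.
Proof.
move=> vS jS.
have sym u : u \in S ->
    #|[set s | rank_in s S u == j]| = #|[set s | rank_in s S v == j]|.
  move=> uS; rewrite -(card_imset _ (@mulgI _ (tperm v u))).
  apply: eq_card => s; apply/imsetP/idP => [[s' + ->]|].
    by rewrite !inE rank_in_tperm.
  rewrite inE => rv; exists (tperm v u * s)%g; last by rewrite mulgA tperm2 mul1g.
  by rewrite inE tpermC rank_in_tperm.
rewrite -sum_nat_const -(eq_bigr _ sym) -cardsT.
apply: leq_trans (_ : #|\bigcup_(u in S) [set s | rank_in s S u == j]| <= _).
  apply: subset_leq_card; apply/subsetP => s _.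
  have [u uS ru] := rank_in_surj s jS.
  by apply/bigcupP; exists u; rewrite // inE ru.
apply: (big_ind2 (fun (A : {set {perm V}}) n => #|A| <= n)) => //.
  by rewrite cards0.
move=> A m B n Am Bn; apply: leq_trans (leq_add Am Bn).
by rewrite cardsU leq_subr.
Qed.

End RandomRank.

(** * Comparing the best order with the average *)

Section Average.

Variables (V : finType) (e : rel V).
Hypotheses (e_sym : symmetric e) (e_irr : irreflexive e).
Implicit Types (s : {perm V}) (v : V).

Definition closed_nbhd v : {set V} := v |: [set u | e v u].

Lemma card_closed_nbhd v : #|closed_nbhd v| = (degree e v).+1.
Proof. by rewrite cardsU1 inE e_irr. Qed.

Definition nbr_rank s v : nat := rank_in s (closed_nbhd v) v.

Lemma nbr_rankE s v :
  nbr_rank s v = #|[set u | earlier_nbr e (position s) v u]|.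
Proof.
apply: eq_card => u; rewrite !inE /earlier_nbr.
by case: eqVneq => [->|]; rewrite ?ltnn ?andbF.
Qed.

(** This is what a single order [s] gives: the vertices of rank 0 and 1 induce a
forest, and the deletions in it are paid for by those of rank 1, which therefore
count with weight [k - 2] instead of [k - 1]. *)
Lemma psi_nbr_rank (k : nat) s : 1 < k ->
  k.-1 * psi e k + k.-1 * #|[set v | nbr_rank s v == 0]|
    + k.-2 * #|[set v | nbr_rank s v == 1]| <= k.-1 * #|V|.
Proof.
move=> k1; have k0 := ltnW k1; set R := [set v | _ == 0]; set F1 := [set v | _ == 1].
have dRF1 : [disjoint R & F1].
  rewrite -setI_eq0; apply/eqP/setP => v; rewrite !inE.
  by case: eqP => // ->.
pose F := R :|: F1.
have cF : #|F| = #|R| + #|F1|.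
  by rewrite cardsU (disjoint_setI0 dRF1) cards0 subn0.
have uF : unique_earlier_nbr e (position s) F.
  move=> x y z xF xy xz; apply/eqP/negPn/negP => yz.
  have yz_sub : [set y; z] \subset [set u | earlier_nbr e (position s) x u].
    by apply/subsetP => u; rewrite !inE => /orP[] /eqP->.
  have := subset_leq_card yz_sub; rewrite cards2 yz -nbr_rankE.
  by case/setUP: xF; rewrite inE => /eqP->.
have [D [DF noPD cD]] :=
  forest_path_cover e_sym e_irr (@position_inj _ s) k0 uF.
have cF1 : #|[set x in F | [exists y, earlier_nbr e (position s) x y]]| <= #|F1|.
  apply: subset_leq_card; apply/subsetP => x; rewrite inE => /andP[xF /existsP[y xy]].
  case/setUP: xF => //; rewrite inE nbr_rankE cards_eq0 => /eqP/setP/(_ y).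
  by rewrite !inE xy.
have psiD : psi e k <= #|~: (F :\: D)|.
  by apply: (psiP e k0).2; rewrite /path_vertex_cover setCK.
have cFD : #|F :\: D| = #|F| - #|D| by rewrite cardsD (setIidPr DF).
have cDF := subset_leq_card DF.
have cC := cardsC (F :\: D).
have psiV : psi e k + #|F| <= #|V| + #|D| by lia.
have kV : k.-1 * (psi e k + #|F|) <= k.-1 * (#|V| + #|D|) by rewrite leq_mul2l psiV orbT.
have kD := leq_trans cD cF1.
have kF1 : k.-1 * #|F1| = k.-2 * #|F1| + #|F1|.
  by rewrite -mulSnr prednK //; lia.
rewrite cF !mulnDr in kV; lia.
Qed.

Lemma sum_nbr_rank (j : nat) :
  \sum_(s : {perm V}) #|[set v | nbr_rank s v == j]|
  = \sum_(v : V) #|[set s | nbr_rank s v == j]|.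
Proof.
under eq_bigr => s _ do rewrite -sum1dep_card.
rewrite (exchange_big_dep xpredT) //=.
by apply: eq_bigr => v _; rewrite sum1dep_card.
Qed.

Local Open Scope ring_scope.

(** This is the expectation bound multiplied by the number of orders; the
hypothesis says that rank [j] exists in every closed neighbourhood. *)
Lemma sum_inv_degree_leq (j : nat) :
  (forall v, j <= degree e v)%N ->
  #|{perm V}|%:R * (\sum_(v : V) 1 / (1 + (degree e v)%:R))
    <= (\sum_(s : {perm V}) #|[set v | nbr_rank s v == j]|)%:R :> rat.
Proof.
move=> jd; rewrite sum_nbr_rank natr_sum mulr_sumr; apply: ler_sum => v _.
have := @card_perm_leq_rank_eq _ (closed_nbhd v) v j.
rewrite card_closed_nbhd ltnS jd setU11 => /(_ isT isT).
rewrite -(ler_nat rat) natrM -addn1 natrD addrC => le_perm.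
by rewrite mul1r ler_pdivrMr 1?mulrC // ltr_wpDr.
Qed.

End Average.

Local Open Scope ring_scope.

Theorem theorem16 (V : finType) (e : rel V)
    (e_sym : symmetric e) (e_irr : irreflexive e)
    (e_noiso : no_isolated_vertex e)
    (k : nat) (k_ge3 : (3 <= k)%N) :
  (psi e k)%:R <= #|V|%:R
     - (2 * k%:R - 3) / (k%:R - 1) * \sum_(v : V) 1 / (1 + (degree e v)%:R)
     :> rat.
Proof.
set S := \sum_(v : V) _.
have le0 := @sum_inv_degree_leq V e e_irr 0 (fun=> isT).
have le1 := @sum_inv_degree_leq V e e_irr 1 e_noiso.
rewrite -/S in le0 le1.
set N0 := (\sum_s _)%N in le0; set N1 := (\sum_s _)%N in le1.
pose n := #|{perm V}|.
have n_gt0 : 0 < n%:R :> rat.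
  by rewrite ltr0n; apply/card_gt0P; exists 1%g.
have total : (n * (k.-1 * psi e k) + k.-1 * N0 + k.-2 * N1 <= n * (k.-1 * #|V|))%N.
  rewrite /n -!sum_nat_const !big_distrr -!big_split /=.
  apply: leq_sum => s _; apply: psi_nbr_rank => //; lia.
move: total; rewrite -(ler_nat rat) !natrD !natrM.
have -> : k.-1%:R = k%:R - 1 :> rat by rewrite -subn1 natrB //; lia.
have -> : k.-2%:R = k%:R - 2 :> rat by rewrite -subn2 natrB //; lia.
have k3 : 3 <= k%:R :> rat by rewrite ler_nat.
rewrite -/n in le0 le1; move=> total.
have k1_gt0 : 0 < k%:R - 1 :> rat by lra.
have w0 : (k%:R - 1) * (n%:R * S) <= (k%:R - 1) * N0%:R by rewrite ler_wpM2l //; lra.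
have w1 : (k%:R - 2) * (n%:R * S) <= (k%:R - 2) * N1%:R by rewrite ler_wpM2l //; lra.
have bound : (k%:R - 1) * (psi e k)%:R + (2 * k%:R - 3) * S <= (k%:R - 1) * #|V|%:R.
  rewrite -(ler_pM2l n_gt0); lra.
rewrite -(ler_pM2l k1_gt0) mulrBr.
have -> : (k%:R - 1) * ((2 * k%:R - 3) / (k%:R - 1) * S) = (2 * k%:R - 3) * S.
  by field; lra.
lra.
Qed.
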